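(* Given $0<a<b<\ell$, there exists $\gamma_0^*=\gamma_0^*(a,b,\ell)>0$ such that $$\forall\alpha\in[1,2),\ \forall m\geq1,\quad \int_a^b\Phi_{\alpha,m}(x)^2\,dx\ \geq\ \gamma_0^*\,(2-\alpha).$$
   Context: For $\alpha\in[1,2)$ set $\nu_\alpha:=\frac{\alpha-1}{2-\alpha}$ and $\kappa_\alpha:=\frac{2-\alpha}{2}$. For $\nu\ge0$, $J_\nu$ is the Bessel function of the first kind of order $\nu$ and $0<j_{\nu,1}<j_{\nu,2}<\cdots$ are its positive zeros. For $\ell>0$ and $m\geq1$, $$\Phi_{\alpha,m}(x)=\frac{\sqrt{2\kappa_\alpha}}{\ell^{\kappa_\alpha}\,|J'_{\nu_\alpha}(j_{\nu_\alpha,m})|}\,x^{(1-\alpha)/2}\,J_{\nu_\alpha}\!\left(j_{\nu_\alpha,m}\Big(\frac{x}{\ell}\Big)^{\kappa_\alpha}\right),\qquad x\in(0,\ell).$$ (These are the $L^2(0,\ell)$-normalized eigenfunctions of $\Phi\mapsto-(x^\alpha\Phi')'$ on $(0,\ell)$ with boundary conditions $(x^\alpha\Phi')(0)=0$, $\Phi(\ell)=0$.) *)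

(* Defs.v *)
From Stdlib Require Export Reals Factorial.
From Coquelicot Require Export Coquelicot.
Open Scope R_scope.

(* Euler's integral, meant for s > 0. *)
Definition Gamma (s : R) : R :=
  RInt_gen (fun t => Rpower t (s - 1) * exp (- t))
    (at_right 0) (Rbar_locally p_infty).

(* J_nu(x) = (x/2)^nu * sum_k (-1)^k (x^2/4)^k / (k! Gamma(k + nu + 1)),
   meant for x > 0 only: Rpower is not the real power at nonpositive bases. *)
Definition bessel_J (nu x : R) : R :=
  Rpower (x / 2) nu *
  PSeries (fun k => (-1) ^ k / (INR (fact k) * Gamma (INR k + nu + 1)))
    (x ^ 2 / 4).

(* For m >= 1 this is j_{nu,m}, the m-th positive zero of J_nu: the least zero
   beyond j_{nu,m-1}, with the convention j_{nu,0} = 0.  The zeros of J_nu in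
   (0, +oo) are simple, unbounded and do not accumulate (not even at 0), so each
   infimum is finite and attained. *)
Fixpoint bessel_zero (nu : R) (m : nat) : R :=
  match m with
  | O => 0
  | S p => real (Glb_Rbar (fun x => bessel_zero nu p < x /\ bessel_J nu x = 0))
  end.

Definition nu_of (alpha : R) : R := (alpha - 1) / (2 - alpha).

Definition kappa_of (alpha : R) : R := (2 - alpha) / 2.

Definition Phi (l alpha : R) (m : nat) (x : R) : R :=
  let nu := nu_of alpha in
  let kappa := kappa_of alpha in
  let j := bessel_zero nu m in
  sqrt (2 * kappa) / (Rpower l kappa * Rabs (Derive (bessel_J nu) j)) *
  Rpower x ((1 - alpha) / 2) *
  bessel_J nu (j * Rpower (x / l) kappa).

(* Main.v *)
Require Import Defs.
From Stdlib Require Import Lra Lia Classical.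

(** With [Y x = J_nu (j (x/l)^kappa)] and [D = x d/dx], Bessel's equation reads
    [D^2 Y = (N - P) Y], where [N = (kappa nu)^2 <= 1/4] and
    [P x = (kappa j)^2 (x/l)^(2 kappa)]. No zero of [J_nu] is below [(nu + 1)/2], so
    [kappa j >= 1/4], and the energy [(D Y)^2 + P Y^2] loses at most a fixed
    factor between [x] in [a, b] and [l], where it equals [(kappa j J_nu'(j))^2].
    A cutoff argument on [a, b] bounds the integral of the energy by a multiple of
    [(kappa j)^2] times that of [Y^2]. Hence the integral of [Y^2] over [a, b] is at
    least [c J_nu'(j)^2] with [c] independent of [nu] and [j]; the factor
    [2 - alpha = 2 kappa] comes from the normalisation of [Phi]. *)

(** * The Gamma function *)

(* Coquelicot states equalities in the carrier of a structure on [R], which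
   [ring] and [field] do not recognise. *)
Ltac real_eq := match goal with |- @eq _ ?x ?y => change (@eq R x y) end.

(** Integrals of a positive function grow with the interval, so their supremum over all [x, y] is
    the improper integral; it is positive because the integral over [1, 2] is. *)
Lemma is_RInt_gen_pos_bounded (f : R -> R) (M : R) :
  (forall t, 0 < t -> 0 < f t) ->
  (forall t, 0 < t -> continuous f t) ->
  (forall x y, 0 < x < y -> RInt f x y <= M) ->
  exists L, 0 < L /\ is_RInt_gen f (at_right 0) (Rbar_locally p_infty) L.
Proof.
intros Hpos Hcont HM.
assert (Hex : forall x y, 0 < x -> 0 < y -> ex_RInt f x y).
{ intros x y Hx Hy; apply @ex_RInt_continuous; intros z [Hz _]; apply Hcont.
  apply Rlt_le_trans with (2 := Hz); now apply Rmin_glb_lt. }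
assert (Hge0 : forall x y, 0 < x <= y -> 0 <= RInt f x y).
{ intros x y Hxy; apply RInt_ge_0; [lra | apply Hex; lra |].
  intros t Ht; apply Rlt_le, Hpos; lra. }
destruct (completeness (fun r => exists x y, 0 < x < y /\ r = RInt f x y))
  as [L [HL1 HL2]].
{ exists M; intros r [x [y [Hxy ->]]]; auto. }
{ exists (RInt f 1 2), 1, 2; split; [lra | easy]. }
exists L; split.
{ apply Rlt_le_trans with (RInt f 1 2).
  - apply RInt_gt_0; [lra | |]; intros t Ht; [apply Hpos | apply Hcont]; lra.
  - apply HL1; exists 1, 2; split; [lra | easy]. }
intros P [eps HP].
assert (Happ : exists x y, 0 < x < y /\ L - eps < RInt f x y).
{ apply NNPP; intros Hn; assert (L <= L - eps); [|destruct eps; simpl in *; lra].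
  apply HL2; intros r [x [y [Hxy ->]]].
  apply Rnot_lt_le; intros Hlt; apply Hn; exists x, y; auto. }
destruct Happ as [x [y [Hxy Hxy']]].
unfold filtermapi; simpl.
(* An interval containing [x, y] has its integral between that over [x, y], which exceeds [L - eps],
   and [L]. *)
apply (Filter_prod _ _ _ (fun u => 0 < u < x) (fun v => y < v)).
- exists (mkposreal x (proj1 Hxy)); intros u Hu Hu0; split; auto.
  unfold ball in Hu; simpl in Hu; unfold AbsRing_ball, abs, minus, plus, opp in Hu.
  simpl in Hu; rewrite Rabs_right in Hu; lra.
- exists y; auto.
- intros u v Hu Hv; exists (RInt f u v); split.
  + apply (RInt_correct f); apply Hex; simpl; lra.
  + apply HP.
    assert (H1 : RInt f u v <= L) by (apply HL1; exists u, v; split; [lra | easy]).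
    assert (H2 : RInt f u v = RInt f u x + RInt f x y + RInt f y v).
    { rewrite <- (RInt_Chasles f u y v), <- (RInt_Chasles f u x y);
        try (apply Hex; lra); reflexivity. }
    assert (H3 := Hge0 u x ltac:(lra)); assert (H4 := Hge0 y v ltac:(lra)).
    unfold ball; simpl; unfold AbsRing_ball, abs, minus, plus, opp; simpl.
    apply Rabs_def1; lra.
Qed.

Lemma exp_nondecreasing (x y : R) : x <= y -> exp x <= exp y.
Proof. intros [H | ->]; [now apply Rlt_le, exp_increasing | lra]. Qed.

Lemma ln_le_sub_1 (x : R) : 0 < x -> ln x <= x - 1.
Proof.
intros Hx; generalize (exp_ineq1_le (ln x)); rewrite exp_ln; lra.
Qed.

(** Exponentiated, this dominates t^p e^(-t) by a multiple of e^(-t/2). It is the tangent bound on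
    ln at [c], chosen so that p/c <= 1/2. *)
Lemma ln_exp_decay (p : R) : 0 <= p ->
  exists K, forall t, 0 < t -> p * ln t - t <= K - t / 2.
Proof.
intros Hp; set (c := 2 * p + 1).
assert (Hc : 0 < c) by (unfold c; lra).
exists (p * ln c); intros t Ht.
assert (H : ln t <= t / c + ln c).
{ generalize (ln_le_sub_1 (t / c) (Rdiv_lt_0_compat _ _ Ht Hc)).
  unfold Rdiv at 1; rewrite ln_mult, ln_Rinv; auto using Rinv_0_lt_compat; lra. }
apply Rmult_le_compat_l with (1 := Hp) in H.
assert (H2 : p * (t / c) <= t / 2); [|lra].
apply Rmult_le_reg_r with (2 * c); [lra|].
replace (p * (t / c) * (2 * c)) with (2 * p * t) by (field; lra).
replace (t / 2 * (2 * c)) with (t * c) by field.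
unfold c; nra.
Qed.

Lemma Rpower_exp (t p : R) : Rpower t p * exp (- t) = exp (p * ln t - t).
Proof. unfold Rpower; now rewrite <- exp_plus. Qed.

(** For [s >= 1] the majorant e^(K - t/2) is valid down to 0. The Bessel coefficients only involve
    arguments k + nu + 1 >= 1. *)
Lemma is_RInt_gen_Gamma (s : R) : 1 <= s ->
  0 < Gamma s /\
  is_RInt_gen (fun t => Rpower t (s - 1) * exp (- t))
    (at_right 0) (Rbar_locally p_infty) (Gamma s).
Proof.
intros Hs.
destruct (ln_exp_decay (s - 1)) as [K HK]; [lra|].
destruct (is_RInt_gen_pos_bounded
  (fun t => Rpower t (s - 1) * exp (- t)) (2 * exp K)) as [L [HL1 HL2]].
- intros t Ht; rewrite Rpower_exp; apply exp_pos.
- intros t Ht; apply (@ex_derive_continuous R_AbsRing R_NormedModule).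
  unfold Rpower; auto_derive; lra.
- intros x y Hxy.
  assert (HI : is_RInt (fun t => exp (K - t / 2)) x y
     (minus (-2 * exp (K - y / 2)) (-2 * exp (K - x / 2)))).
  { apply (is_RInt_derive (fun t => -2 * exp (K - t / 2))).
    - intros t _; auto_derive; auto; unfold Rminus, Rdiv; real_eq; field.
    - intros t _; apply (@ex_derive_continuous R_AbsRing R_NormedModule).
      auto_derive; auto. }
  apply Rle_trans with (RInt (fun t => exp (K - t / 2)) x y).
  + apply RInt_le; [lra | | eexists; apply HI |].
    * apply @ex_RInt_continuous; intros t Ht.
      rewrite Rmin_left in Ht; [|lra].
      apply (@ex_derive_continuous R_AbsRing R_NormedModule).
      unfold Rpower; auto_derive; lra.
    * intros t Ht; rewrite Rpower_exp; apply exp_nondecreasing, HK; lra.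
  + rewrite (is_RInt_unique _ _ _ _ HI); unfold minus, plus, opp; simpl.
    assert (exp (K - x / 2) <= exp K) by (apply exp_nondecreasing; lra).
    generalize (exp_pos (K - y / 2)); lra.
- unfold Gamma; rewrite (is_RInt_gen_unique _ _ HL2); auto.
Qed.

(** Integration by parts: [g] vanishes at 0 and at infinity, so its derivative has zero integral,
    which is subtracted from s times the integral for [Gamma s]. *)
Lemma Gamma_succ (s : R) : 1 <= s -> Gamma (s + 1) = s * Gamma s.
Proof.
intros Hs.
set (g := fun t => Rpower t s * exp (- t)).
assert (Hd : forall t, 0 < t -> is_derive g t
  (s * (Rpower t (s - 1) * exp (- t)) - Rpower t (s + 1 - 1) * exp (- t))).
{ intros t Ht; unfold g; replace (s + 1 - 1) with s by ring.
  replace (Rpower t (s - 1)) with (Rpower t s / t).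
  - unfold Rpower; auto_derive; [lra|]; field; lra.
  - unfold Rminus; rewrite Rpower_plus, Rpower_Ropp, Rpower_1; auto. }
assert (Hpr : filter_prod (at_right 0) (Rbar_locally p_infty)
   (fun ab => forall x, Rmin (fst ab) (snd ab) <= x <= Rmax (fst ab) (snd ab) -> 0 < x)).
{ apply (Filter_prod _ _ _ (fun u => 0 < u) (fun v => 0 < v)).
  - exists (mkposreal 1 Rlt_0_1); auto.
  - exists 0; auto.
  - simpl; intros u v Hu Hv x [Hx _]; apply Rlt_le_trans with (2 := Hx).
    now apply Rmin_glb_lt. }
assert (Hball : forall eps t, 0 < g t < eps -> ball 0 eps (g t)).
{ intros eps t Ht; unfold ball; simpl; unfold AbsRing_ball, abs, minus, plus, opp.
  simpl; apply Rabs_def1; lra. }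
assert (HI : is_RInt_gen (Derive g) (at_right 0) (Rbar_locally p_infty) (0 - 0)).
{ apply is_RInt_gen_Derive; try apply filter_imp with (2 := Hpr).
  - intros ab H x Hx; eexists; apply Hd; auto.
  - intros ab H x Hx.
    specialize (H x Hx); eapply continuous_ext_loc.
    + apply (locally_open (fun y => 0 < y)); [apply open_gt | | exact H].
      intros y Hy; symmetry; apply (is_derive_unique _ _ _ (Hd y Hy)).
    + apply (@ex_derive_continuous R_AbsRing R_NormedModule).
      unfold Rpower; auto_derive; auto.
  - intros P [eps HP].
    (* The threshold is eps^(1/s): below it t^s < eps, while e^(-t) < 1. *)
    assert (He : 0 < exp (ln eps / s)) by apply exp_pos.
    exists (mkposreal _ He); intros t Ht Ht0; apply HP, Hball.
    unfold ball in Ht; simpl in Ht; unfold AbsRing_ball, abs, minus, plus, opp in Ht.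
    simpl in Ht; rewrite Rabs_right in Ht; [|lra].
    unfold g; rewrite Rpower_exp; split; [apply exp_pos|].
    rewrite <- (exp_ln eps) by apply cond_pos; apply exp_increasing.
    apply Rlt_trans with (s * ln t); [lra|].
    assert (H : ln t < ln eps / s).
    { rewrite <- (ln_exp (ln eps / s)); apply ln_increasing; lra. }
    apply Rmult_lt_compat_l with (r := s) in H; [|lra].
    replace (s * (ln eps / s)) with (ln eps) in H by (field; lra); auto.
  - intros P [eps HP].
    destruct (ln_exp_decay s) as [K HK]; [lra|].
    exists (Rmax 0 (2 * (K - ln eps))); intros t Ht; apply HP, Hball.
    assert (0 < t) by (apply Rle_lt_trans with (2 := Ht), Rmax_l).
    assert (2 * (K - ln eps) < t) by (apply Rle_lt_trans with (2 := Ht), Rmax_r).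
    unfold g; rewrite Rpower_exp; split; [apply exp_pos|].
    rewrite <- (exp_ln eps) by apply cond_pos; apply exp_increasing.
    apply Rle_lt_trans with (K - t / 2); auto; lra. }
destruct (is_RInt_gen_Gamma s Hs) as [_ HG].
apply is_RInt_gen_unique.
assert (HM := is_RInt_gen_minus _ _ _ _ (is_RInt_gen_scal _ s _ HG) HI).
match type of HM with is_RInt_gen _ _ _ ?L => replace L with (s * Gamma s) in HM end.
2: { unfold minus, plus, opp, scal; simpl; unfold mult; simpl; real_eq; ring. }
revert HM; apply is_RInt_gen_ext.
apply filter_imp with (2 := Hpr); intros ab H x Hx.
rewrite (is_derive_unique _ _ _ (Hd x (H x ltac:(lra)))).
unfold minus, plus, opp, scal; simpl; unfold mult; simpl; ring.
Qed.

(** * Bessel's equation *)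

Definition bessel_coef (nu : R) (k : nat) : R :=
  (-1) ^ k / (INR (fact k) * Gamma (INR k + nu + 1)).

(** This recurrence and the positivity of the coefficient of index 0 are all that is used of [Gamma]
    from here on. *)
Lemma bessel_coef_succ (nu : R) (k : nat) : 0 <= nu ->
  (INR k + 1) * (INR k + 1 + nu) * bessel_coef nu (S k) = - bessel_coef nu k.
Proof.
intros Hnu; unfold bessel_coef.
assert (Hk := pos_INR k).
replace (INR (S k) + nu + 1) with ((INR k + nu + 1) + 1) by (rewrite S_INR; ring).
rewrite Gamma_succ by lra.
destruct (is_RInt_gen_Gamma (INR k + nu + 1)) as [HG _]; [lra|].
replace (fact (S k)) with (S k * fact k)%nat by reflexivity.
rewrite mult_INR, S_INR; simpl pow.
assert (Hf := INR_fact_neq_0 k).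
field; repeat split; try lra; auto.
Qed.

Lemma bessel_coef_0_pos (nu : R) : 0 <= nu -> 0 < bessel_coef nu 0.
Proof.
intros Hnu; unfold bessel_coef; simpl.
destruct (is_RInt_gen_Gamma (0 + nu + 1)) as [HG _]; [lra|].
apply Rdiv_lt_0_compat; lra.
Qed.

Lemma bessel_coef_neq_0 (nu : R) (k : nat) : 0 <= nu -> bessel_coef nu k <> 0.
Proof.
intros Hnu; induction k as [|k IH].
- generalize (bessel_coef_0_pos nu Hnu); lra.
- intros H; apply IH; generalize (bessel_coef_succ nu k Hnu); rewrite H; lra.
Qed.

Lemma bessel_coef_le (nu : R) (k : nat) : 0 <= nu ->
  Rabs (bessel_coef nu k) <= bessel_coef nu 0.
Proof.
intros Hnu; induction k as [|k IH].
- generalize (bessel_coef_0_pos nu Hnu); intros; rewrite Rabs_right; lra.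
- apply Rle_trans with (2 := IH).
  rewrite <- (Rabs_Ropp (bessel_coef nu k)), <- bessel_coef_succ, Rabs_mult by auto.
  assert (Hk := pos_INR k); assert (Hp := Rabs_pos (bessel_coef nu (S k))).
  rewrite (Rabs_right (_ * _)) by (apply Rle_ge, Rmult_le_pos; lra).
  assert (1 <= (INR k + 1) * (INR k + 1 + nu)) by nra; nra.
Qed.

Lemma CV_radius_bessel_coef (nu : R) : 0 <= nu ->
  CV_radius (bessel_coef nu) = p_infty.
Proof.
intros Hnu; apply CV_radius_infinite_DAlembert.
{ intros n; now apply bessel_coef_neq_0. }
apply is_lim_seq_le_le with (u := fun _ => 0) (w := fun n => / INR (S n)).
- intros n; split; [apply Rabs_pos|].
  assert (Hn := pos_INR n); assert (H0 := bessel_coef_neq_0 nu n Hnu).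
  replace (bessel_coef nu (S n) / bessel_coef nu n)
    with (- / ((INR n + 1) * (INR n + 1 + nu))).
  + rewrite Rabs_Ropp, Rabs_right, S_INR.
    * apply Rinv_le_contravar; nra.
    * apply Rle_ge, Rlt_le, Rinv_0_lt_compat; nra.
  + assert (H := bessel_coef_succ nu n Hnu).
    apply Rmult_eq_reg_r with (bessel_coef nu n); auto.
    replace (bessel_coef nu n) with
      (- ((INR n + 1) * (INR n + 1 + nu) * bessel_coef nu (S n))) at 1 by lra.
    field; lra.
- apply is_lim_seq_const.
- apply (is_lim_seq_incr_1 (fun n => / INR n)).
  replace (Finite 0) with (Rbar_inv p_infty) by reflexivity.
  apply is_lim_seq_inv; [apply is_lim_seq_INR | discriminate].
Qed.

(* The entire function with [J_nu x = (x/2)^nu * bessel_F nu (x^2/4)]. *)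
Definition bessel_F (nu : R) : R -> R := PSeries (bessel_coef nu).
Definition bessel_F' (nu : R) : R -> R := PSeries (PS_derive (bessel_coef nu)).

Lemma is_derive_bessel_F (nu u : R) : 0 <= nu ->
  is_derive (bessel_F nu) u (bessel_F' nu u).
Proof.
intros Hnu; apply is_derive_PSeries.
now rewrite CV_radius_bessel_coef.
Qed.

(** The coefficient of u^k on the left of the equation is (k+1)(k+1+nu) a_(k+1) + a_k, zero by
    [bessel_coef_succ]. *)
Lemma is_derive_bessel_F' (nu u : R) : 0 <= nu ->
  exists F'', is_derive (bessel_F' nu) u F'' /\
    u * F'' + (nu + 1) * bessel_F' nu u + bessel_F nu u = 0.
Proof.
intros Hnu.
set (a := bessel_coef nu).
assert (H0 : CV_radius a = p_infty) by now apply CV_radius_bessel_coef.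
assert (H1 : CV_radius (PS_derive a) = p_infty) by now rewrite CV_radius_derive.
assert (H2 : CV_radius (PS_derive (PS_derive a)) = p_infty)
  by now rewrite CV_radius_derive.
exists (PSeries (PS_derive (PS_derive a)) u); split.
{ apply is_derive_PSeries; fold a; now rewrite H1. }
unfold bessel_F', bessel_F; fold a.
assert (E0 : ex_pseries a u) by (apply CV_radius_inside; now rewrite H0).
assert (E1 : ex_pseries (PS_derive a) u) by (apply CV_radius_inside; now rewrite H1).
assert (E2 : ex_pseries (PS_derive (PS_derive a)) u)
  by (apply CV_radius_inside; now rewrite H2).
rewrite <- PSeries_incr_1, <- PSeries_scal, <- !PSeries_plus; auto.
- rewrite <- (PSeries_const_0 u); apply PSeries_ext; intros [|k].
  + change (0 + (nu + 1) * (INR 1 * a 1%nat) + a 0%nat = 0).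
    assert (H := bessel_coef_succ nu 0 Hnu); fold a in H; simpl in *; lra.
  + change (INR (S k) * (INR (S (S k)) * a (S (S k)))
      + (nu + 1) * (INR (S (S k)) * a (S (S k))) + a (S k) = 0).
    assert (H := bessel_coef_succ nu (S k) Hnu); fold a in H.
    rewrite !S_INR in *; lra.
- apply ex_pseries_plus; [now apply ex_pseries_incr_1|].
  apply ex_pseries_scal; auto; apply Rmult_comm.
- now apply ex_pseries_incr_1.
- apply ex_pseries_scal; auto; apply Rmult_comm.
Qed.

(** This is x J_nu'(x). With the operator x d/dx, Bessel's equation has no first-order term and
    becomes a system in J and x J'. *)
Definition bessel_xJ' (nu x : R) : R :=
  Rpower (x / 2) nu *
  (nu * bessel_F nu (x ^ 2 / 4) + 2 * (x ^ 2 / 4) * bessel_F' nu (x ^ 2 / 4)).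

Lemma is_derive_Rpower_half (nu x : R) : 0 < x ->
  is_derive (fun x => Rpower (x / 2) nu) x (nu / x * Rpower (x / 2) nu).
Proof. intros Hx; unfold Rpower; auto_derive; [lra|]; unfold Rminus, Rdiv; real_eq; field; lra. Qed.

Lemma is_derive_bessel_J (nu x : R) : 0 <= nu -> 0 < x ->
  is_derive (bessel_J nu) x (bessel_xJ' nu x / x).
Proof.
intros Hnu Hx.
assert (HF := is_derive_bessel_F nu (x ^ 2 / 4) Hnu).
apply is_derive_ext with (fun x => Rpower (x / 2) nu * bessel_F nu (x ^ 2 / 4));
  [reflexivity|].
assert (HP := is_derive_Rpower_half nu x Hx).
evar_last.
- apply (is_derive_mult (fun x => Rpower (x / 2) nu) (fun x => bessel_F nu (x ^ 2 / 4)));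
    [exact HP | | apply Rmult_comm].
  apply (is_derive_comp (bessel_F nu) (fun x => x ^ 2 / 4)); [exact HF|].
  auto_derive; auto.
- unfold bessel_xJ', plus, scal, mult; simpl; unfold mult; simpl; unfold Rminus, Rdiv; real_eq; field; lra.
Qed.

Lemma is_derive_bessel_xJ' (nu x : R) : 0 <= nu -> 0 < x ->
  is_derive (bessel_xJ' nu) x ((nu ^ 2 - x ^ 2) * bessel_J nu x / x).
Proof.
intros Hnu Hx.
assert (HF := is_derive_bessel_F nu (x ^ 2 / 4) Hnu).
destruct (is_derive_bessel_F' nu (x ^ 2 / 4) Hnu) as [F'' [HF' Hode]].
assert (HP := is_derive_Rpower_half nu x Hx).
set (u := fun x : R => x ^ 2 / 4) in *.
assert (Hu : is_derive u x (x / 2)) by (unfold u; auto_derive; auto; unfold Rminus, Rdiv; real_eq; field).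
evar_last.
- apply (is_derive_mult (fun x => Rpower (x / 2) nu) (fun x =>
    nu * bessel_F nu (u x) + 2 * u x * bessel_F' nu (u x)));
    [exact HP | | apply Rmult_comm].
  apply (is_derive_plus (fun x => nu * bessel_F nu (u x))
     (fun x => 2 * u x * bessel_F' nu (u x))).
  + apply is_derive_scal, (is_derive_comp (bessel_F nu) u); [exact HF | exact Hu].
  + apply (is_derive_mult (fun x => 2 * u x) (fun x => bessel_F' nu (u x)));
      [apply is_derive_scal, Hu | | apply Rmult_comm].
    apply (is_derive_comp (bessel_F' nu) u); [exact HF' | exact Hu].
- change (bessel_J nu x) with (Rpower (x / 2) nu * bessel_F nu (x ^ 2 / 4)).
  unfold plus, scal, mult; simpl; unfold mult; simpl; real_eq.
  change (x * (x * 1) / 4) with (u x) in *.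
  apply Rmult_eq_reg_r with x; [|lra].
  (* The two sides differ by a multiple of the equation satisfied by [bessel_F]. *)
  match goal with |- ?A = ?B => assert (A - B = Rpower (x / 2) nu * x ^ 2 *
     (u x * F'' + (nu + 1) * bessel_F' nu (u x) + bessel_F nu (u x))) end.
  { replace (x ^ 2) with (4 * u x) by (unfold u; field).
    change (x * (x * 1)) with (x ^ 2); replace (x ^ 2) with (4 * u x) by (unfold u; field).
    field_simplify; [|lra]. replace (x ^ 2) with (4 * u x) by (unfold u; field). field. }
  change (u x * F'' + (nu + 1) * bessel_F' nu (u x) + bessel_F nu (u x) = 0) in Hode.
  rewrite Hode in H; lra.
Qed.

(** The constant term [a0] dominates: the rest is u times a series of modulus at most a0 times the
    sum of 4^(-n), that is 4 a0 / 3. The range of u is that of x^2/4 for x <= 1. *)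
Lemma bessel_F_pos (nu u : R) : 0 <= nu -> 0 <= u <= 1 / 4 -> 0 < bessel_F nu u.
Proof.
intros Hnu Hu; unfold bessel_F.
assert (H0 := bessel_coef_0_pos nu Hnu); set (a0 := bessel_coef nu 0) in *.
rewrite PSeries_decr_1; fold a0.
2: { apply CV_radius_inside; now rewrite CV_radius_bessel_coef. }
assert (Hq : Rabs (1 / 4) < 1) by (rewrite Rabs_right; lra).
assert (Hg : ex_series (fun n => a0 * (1 / 4) ^ n))
  by (apply (ex_series_scal_l a0 (fun n => (1 / 4) ^ n)); now apply ex_series_geom).
assert (Hle : forall n, 0 <= Rabs (PS_decr_1 (bessel_coef nu) n * u ^ n)
   <= a0 * (1 / 4) ^ n).
{ intros n; split; [apply Rabs_pos|].
  rewrite Rabs_mult; apply Rmult_le_compat; try apply Rabs_pos.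
  - apply bessel_coef_le; auto.
  - rewrite Rabs_right; [apply pow_incr; lra | apply Rle_ge, pow_le; lra]. }
assert (Hs : ex_series (fun n => Rabs (PS_decr_1 (bessel_coef nu) n * u ^ n))).
{ apply (ex_series_le (K := R_AbsRing) (V := R_CompleteNormedModule) _
    (fun n => a0 * (1 / 4) ^ n)); auto.
  intros n; change (Rabs (Rabs (PS_decr_1 (bessel_coef nu) n * u ^ n)) <= a0 * (1 / 4) ^ n).
  rewrite Rabs_Rabsolu; apply Hle. }
assert (HS := Series_Rabs _ Hs).
assert (HL := Series_le _ _ Hle Hg).
rewrite Series_scal_l, Series_geom in HL by auto.
change (PSeries (PS_decr_1 (bessel_coef nu)) u) with
  (Series (fun n => PS_decr_1 (bessel_coef nu) n * u ^ n)).
set (S := Series (fun n => PS_decr_1 (bessel_coef nu) n * u ^ n)) in *.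
destruct (Rabs_def2 S (a0 * 2)) as [HS1 HS2]; nra.
Qed.

(** * Zeros of Bessel functions *)

Lemma nonneg_derive_le (f df : R -> R) (a b : R) : a <= b ->
  (forall x, a <= x <= b -> is_derive f x (df x)) ->
  (forall x, a <= x <= b -> 0 <= df x) ->
  f a <= f b.
Proof.
intros Hab Hd Hpos.
destruct (MVT_gen f a b df) as [c [Hc Heq]];
  rewrite ?Rmin_left, ?Rmax_right in *; auto.
- intros x Hx; apply Hd; lra.
- intros x Hx; apply continuity_pt_filterlim.
  apply (@ex_derive_continuous R_AbsRing R_NormedModule).
  eexists; apply Hd; lra.
- assert (0 <= df c * (b - a)) by (apply Rmult_le_pos; [apply Hpos; lra | lra]); lra.
Qed.

(** The function e^(c (b - x)) f(x) is nonincreasing. Both [f] and [c] may be negative, as in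
    [bessel_J_derive_neq_0]. *)
Lemma gronwall_le (f df : R -> R) (c a b : R) : a <= b ->
  (forall x, a <= x <= b -> is_derive f x (df x)) ->
  (forall x, a <= x <= b -> df x <= c * f x) ->
  f b <= exp (c * (b - a)) * f a.
Proof.
intros Hab Hd Hle.
assert (H := nonneg_derive_le (fun x => - (exp (c * (b - x)) * f x))
  (fun x => exp (c * (b - x)) * (c * f x - df x)) a b Hab).
simpl in H; rewrite Rminus_diag, Rmult_0_r, exp_0 in H.
enough (- (exp (c * (b - a)) * f a) <= - (1 * f b)) by lra.
apply H; intros x Hx.
- evar_last.
  + apply (is_derive_opp (fun x => exp (c * (b - x)) * f x)).
    apply (is_derive_mult (fun x => exp (c * (b - x))) f);
      [auto_derive; auto | apply Hd, Hx | apply Rmult_comm].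
  + unfold opp, plus, mult; simpl; unfold Rminus; real_eq; ring.
- apply Rmult_le_pos; [apply Rlt_le, exp_pos|]; specialize (Hle x Hx); lra.
Qed.

Lemma bessel_J_pos_le_1 (nu x : R) : 0 <= nu -> 0 < x <= 1 -> 0 < bessel_J nu x.
Proof.
intros Hnu Hx; unfold bessel_J; apply Rmult_lt_0_compat; [apply exp_pos|].
apply (bessel_F_pos nu); auto; nra.
Qed.

(** The product is (x/2)^(2 nu) G(x^2/4) with [G] continuous at 0 and G(0) = nu F(0)^2 > 0. It
    starts the monotonicity argument of the lemma below. *)
Lemma bessel_J_xJ'_pos_near_0 (nu : R) : 0 < nu ->
  exists d, 0 < d /\
    forall x, 0 < x < d -> 0 < bessel_J nu x * bessel_xJ' nu x.
Proof.
intros Hnu.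
set (G := fun u => bessel_F nu u * (nu * bessel_F nu u + 2 * u * bessel_F' nu u)).
assert (HG0 : 0 < G 0).
{ unfold G; assert (H := bessel_F_pos nu 0 ltac:(lra) ltac:(lra)).
  rewrite Rmult_0_r, Rmult_0_l, Rplus_0_r; apply Rmult_lt_0_compat; nra. }
assert (HGc : continuous G 0).
{ apply (@ex_derive_continuous R_AbsRing R_NormedModule); unfold G.
  destruct (is_derive_bessel_F' nu 0) as [F'' [H' _]]; [lra|].
  assert (H := is_derive_bessel_F nu 0 ltac:(lra)).
  auto_derive; repeat split; eexists; eauto. }
destruct (HGc (fun v => 0 < v)) as [e He].
{ apply (locally_open (fun v => 0 < v)); auto; apply open_gt. }
exists (Rmin 1 e); split; [apply Rmin_glb_lt; [lra | apply cond_pos]|].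
intros x [Hx Hxd].
assert (Hx1 : x < 1) by (apply Rlt_le_trans with (1 := Hxd), Rmin_l).
assert (Hxe : x < e) by (apply Rlt_le_trans with (1 := Hxd), Rmin_r).
assert (HG : 0 < G (x ^ 2 / 4)).
{ apply He; unfold ball; simpl; unfold AbsRing_ball, abs, minus, plus, opp; simpl.
  apply Rabs_def1; nra. }
replace (bessel_J nu x * bessel_xJ' nu x)
  with (Rpower (x / 2) nu * Rpower (x / 2) nu * G (x ^ 2 / 4)).
2: { unfold bessel_J, bessel_xJ', G, bessel_F, bessel_coef; ring. }
assert (H := exp_pos (nu * ln (x / 2))); fold (Rpower (x / 2) nu) in H.
apply Rmult_lt_0_compat; auto; now apply Rmult_lt_0_compat.
Qed.

(* [x -> J(x) * x J'(x)] has derivative [(x J')^2 / x + (nu^2 - x^2) J^2 / x],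
   so it increases from 0 as long as [x <= nu]. *)
Lemma bessel_J_neq_0_le_order (nu x : R) : 0 < x <= nu -> bessel_J nu x <> 0.
Proof.
intros Hx.
destruct (bessel_J_xJ'_pos_near_0 nu) as [d [Hd Hpos]]; [lra|].
set (y := Rmin x (d / 2)).
assert (Hy : 0 < y) by (apply Rmin_glb_lt; lra).
assert (Hyx : y <= x) by apply Rmin_l.
assert (Hyd : y <= d / 2) by apply Rmin_r.
assert (H : bessel_J nu y * bessel_xJ' nu y <= bessel_J nu x * bessel_xJ' nu x).
{ apply (nonneg_derive_le (fun x => bessel_J nu x * bessel_xJ' nu x) (fun x =>
    (bessel_xJ' nu x ^ 2 + (nu ^ 2 - x ^ 2) * bessel_J nu x ^ 2) / x)); auto;
  intros t Ht.
  - evar_last.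
    + apply (is_derive_mult (bessel_J nu) (bessel_xJ' nu));
        [apply is_derive_bessel_J | apply is_derive_bessel_xJ' | apply Rmult_comm]; lra.
    + unfold plus, mult; simpl; unfold Rminus, Rdiv; real_eq; ring.
  - apply Rmult_le_pos; [|apply Rlt_le, Rinv_0_lt_compat; lra].
    apply Rplus_le_le_0_compat; [apply pow2_ge_0|].
    apply Rmult_le_pos; [nra | apply pow2_ge_0]. }
assert (H0 := Hpos y ltac:(lra)).
intros Hz; rewrite Hz in H; lra.
Qed.

(** A zero exceeds both 1 and nu, hence their mean. This form makes kappa j >= 1/4 uniformly in nu,
    as kappa = 1/(2(nu+1)). *)
Lemma bessel_J_zero_ge (nu x : R) : 0 <= nu -> 0 < x -> bessel_J nu x = 0 ->
  (nu + 1) / 2 <= x.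
Proof.
intros Hnu Hx Hz.
assert (1 < x).
{ apply Rnot_le_lt; intros H; generalize (bessel_J_pos_le_1 nu x Hnu); lra. }
assert (nu < x); [|lra].
apply Rnot_le_lt; intros H'; now apply (bessel_J_neq_0_le_order nu x).
Qed.

(** If J and x J' both vanished at x, Gronwall's inequality for J^2 + (x J')^2 would force J(1) = 0.
    The sign of [E] is reversed to propagate from x back to 1. *)
Lemma bessel_J_derive_neq_0 (nu x : R) : 0 <= nu -> 0 < x -> bessel_J nu x = 0 ->
  bessel_xJ' nu x <> 0.
Proof.
intros Hnu Hx Hz H'z.
assert (H1 : 1 < x).
{ apply Rnot_le_lt; intros H; generalize (bessel_J_pos_le_1 nu x Hnu); lra. }
set (E := fun t => - (bessel_J nu t ^ 2 + bessel_xJ' nu t ^ 2)).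
assert (H := gronwall_le E (fun t =>
  - 2 * bessel_J nu t * bessel_xJ' nu t * (1 + nu ^ 2 - t ^ 2) / t)
  (- (1 + nu ^ 2 + x ^ 2)) 1 x ltac:(lra)).
assert (HE : E x = 0) by (unfold E; rewrite Hz, H'z; ring).
rewrite HE in H.
assert (HE1 : E 1 < 0).
{ unfold E; generalize (bessel_J_pos_le_1 nu 1 Hnu ltac:(lra)); nra. }
enough (0 <= exp (- (1 + nu ^ 2 + x ^ 2) * (x - 1)) * E 1).
{ generalize (exp_pos (- (1 + nu ^ 2 + x ^ 2) * (x - 1))); nra. }
apply H; intros t Ht.
- assert (HJ := is_derive_bessel_J nu t Hnu ltac:(lra)).
  assert (HJ' := is_derive_bessel_xJ' nu t Hnu ltac:(lra)).
  unfold E; auto_derive; [repeat split; eexists; eauto|].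
  change (Derive (fun x0 : R => bessel_J nu x0) t) with (Derive (bessel_J nu) t).
  change (Derive (fun x0 : R => bessel_xJ' nu x0) t) with (Derive (bessel_xJ' nu) t).
  rewrite (is_derive_unique _ _ _ HJ), (is_derive_unique _ _ _ HJ').
  unfold Rminus, Rdiv; real_eq; ring.
- unfold E; set (p := bessel_J nu t); set (q := bessel_xJ' nu t).
  assert (Hpq : Rabs (2 * p * q) <= p ^ 2 + q ^ 2) 
    by (apply Rabs_le; generalize (pow2_ge_0 (p + q)) (pow2_ge_0 (p - q)); lra).
  assert (Hc : Rabs ((1 + nu ^ 2 - t ^ 2) / t) <= 1 + nu ^ 2 + x ^ 2).
  { unfold Rdiv; rewrite Rabs_mult, (Rabs_right (/ t)).
    2: { apply Rle_ge, Rlt_le, Rinv_0_lt_compat; lra. }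
    assert (t ^ 2 <= x ^ 2) by nra; assert (0 <= t ^ 2) by nra.
    assert (0 <= nu ^ 2) by nra.
    assert (Rabs (1 + nu ^ 2 - t ^ 2) <= 1 + nu ^ 2 + x ^ 2) by (apply Rabs_le; lra).
    assert (/ t <= 1) by (rewrite <- Rinv_1; apply Rinv_le_contravar; lra).
    assert (0 < / t) by (apply Rinv_0_lt_compat; lra).
    generalize (Rabs_pos (1 + nu ^ 2 - t ^ 2)); nra. }
  assert (Hm := Rmult_le_compat _ _ _ _ (Rabs_pos _) (Rabs_pos _) Hpq Hc).
  rewrite <- Rabs_mult in Hm.
  assert (H0 := Rle_abs (- (2 * p * q * ((1 + nu ^ 2 - t ^ 2) / t)))).
  rewrite Rabs_Ropp in H0; unfold Rdiv in *; lra.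
Qed.

(* Sturm comparison with [sin (ln x)]: in the variable [ln x], [J_nu] solves
   [w'' + (x^2 - nu^2) w = 0] with [x^2 - nu^2 >= 1] for large [x]. *)
Lemma sturm_bessel (nu x0 s : R) : 0 <= nu -> 1 + nu <= x0 ->
  (forall x, x0 <= x <= x0 * exp PI -> 0 <= s * bessel_J nu x) ->
  s * bessel_J nu (x0 * exp PI) <= - (s * bessel_J nu x0).
Proof.
intros Hnu Hx0 Hs.
(* [th] runs from 0 to PI on the interval. The function below is s times the Wronskian of sin(th)
   and J in the variable ln x; it is nondecreasing while s J >= 0. *)
set (th := fun x => ln x - ln x0).
assert (HeP : 1 < exp PI) by (rewrite <- exp_0; apply exp_increasing, PI_RGT_0).
assert (Hx01 : x0 <= x0 * exp PI) by nra.
assert (H := nonneg_derive_le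
  (fun x => - (s * (bessel_xJ' nu x * sin (th x) - bessel_J nu x * cos (th x))))
  (fun x => (x ^ 2 - nu ^ 2 - 1) * (s * bessel_J nu x) * sin (th x) / x)
  x0 (x0 * exp PI) Hx01).
assert (Ht0 : th x0 = 0) by (unfold th; ring).
assert (Ht1 : th (x0 * exp PI) = PI).
{ unfold th; rewrite ln_mult, ln_exp; [ring | lra | lra]. }
simpl in H; rewrite Ht0, Ht1, sin_0, cos_0, sin_PI, cos_PI in H.
enough (- (s * (bessel_xJ' nu x0 * 0 - bessel_J nu x0 * 1)) <=
   - (s * (bessel_xJ' nu (x0 * exp PI) * 0 - bessel_J nu (x0 * exp PI) * -1))) by lra.
apply H; intros x Hx.
- assert (HJ := is_derive_bessel_J nu x Hnu ltac:(lra)).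
  assert (HJ' := is_derive_bessel_xJ' nu x Hnu ltac:(lra)).
  unfold th; auto_derive; [repeat split; try lra; eexists; eauto|].
  change (Derive (fun x0 : R => bessel_J nu x0) x) with (Derive (bessel_J nu) x).
  change (Derive (fun x0 : R => bessel_xJ' nu x0) x) with (Derive (bessel_xJ' nu) x).
  rewrite (is_derive_unique _ _ _ HJ), (is_derive_unique _ _ _ HJ').
  unfold Rminus, Rdiv; real_eq; ring.
- assert (0 <= th x <= PI).
  { rewrite <- Ht1; unfold th.
    assert (ln x0 <= ln x) by (apply ln_le; lra).
    assert (ln x <= ln (x0 * exp PI)) by (apply ln_le; lra). lra. }
  assert (0 <= sin (th x)) by (apply sin_ge_0; lra).
  apply Rmult_le_pos; [|apply Rlt_le, Rinv_0_lt_compat; lra].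
  apply Rmult_le_pos; auto; apply Rmult_le_pos; auto; nra.
Qed.

Lemma continuity_pt_bessel_J (nu x : R) : 0 <= nu -> 0 < x ->
  continuity_pt (bessel_J nu) x.
Proof.
intros Hnu Hx; apply continuity_pt_filterlim.
apply (@ex_derive_continuous R_AbsRing R_NormedModule).
eexists; now apply is_derive_bessel_J.
Qed.

(** With s = J(x0), [sturm_bessel] forbids J to keep the sign of s on [x0, x0 e^PI], so the
    intermediate value theorem gives a zero there. *)
Lemma bessel_J_zeros_unbounded (nu T : R) : 0 <= nu ->
  exists x, T < x /\ bessel_J nu x = 0.
Proof.
intros Hnu.
set (x0 := Rmax (1 + nu) (T + 1)).
assert (H1 : 1 + nu <= x0) by apply Rmax_l.
assert (H2 : T + 1 <= x0) by apply Rmax_r.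
destruct (classic (bessel_J nu x0 = 0)) as [Hz | Hnz].
{ exists x0; split; auto; lra. }
set (s := bessel_J nu x0).
assert (Hs : 0 < s * s) by (generalize (Rsqr_pos_lt s Hnz); auto).
destruct (classic (forall x, x0 <= x <= x0 * exp PI -> 0 <= s * bessel_J nu x))
  as [Hall | Hn].
{ exfalso; assert (H := sturm_bessel nu x0 s Hnu H1 Hall); fold s in H.
  assert (HeP : 1 < exp PI) by (rewrite <- exp_0; apply exp_increasing, PI_RGT_0).
  specialize (Hall (x0 * exp PI) ltac:(nra)); lra. }
apply not_all_ex_not in Hn; destruct Hn as [y Hy].
apply imply_to_and in Hy; destruct Hy as [Hy Hsy].
apply Rnot_le_lt in Hsy.
destruct (Ranalysis5.IVT_interv (fun x => - (s * bessel_J nu x)) x0 y) as [z [Hz Hz0]].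
- intros a Ha; apply continuity_pt_opp, continuity_pt_scal.
  apply continuity_pt_bessel_J; lra.
- destruct (proj1 Hy) as [|He]; auto; subst y; fold s in Hsy; lra.
- fold s; lra.
- lra.
- exists z; split; [lra|].
  assert (Hsz : s * bessel_J nu z = 0) by lra.
  apply Rmult_integral in Hsz; destruct Hsz as [Hs0 |]; auto; now elim Hnz.
Qed.

Lemma bessel_zero_nonneg_spec (nu : R) (m : nat) : 0 <= nu ->
  0 <= bessel_zero nu m /\
  ((1 <= m)%nat -> 0 < bessel_zero nu m /\ bessel_J nu (bessel_zero nu m) = 0).
Proof.
intros Hnu; induction m as [|m [IH _]]; [split; [simpl; lra | lia]|].
enough (H : 0 < bessel_zero nu (S m) /\ bessel_J nu (bessel_zero nu (S m)) = 0)
  by (split; [lra | auto]).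
simpl; set (S := fun x => _ /\ _).
destruct (Glb_Rbar_correct S) as [Hlb Hglb].
destruct (bessel_J_zeros_unbounded nu (bessel_zero nu m) Hnu) as [x0 Hx0].
(* This bound and the zero [x0] make the infimum finite; [real] would turn an infinite one into
   0. *)
assert (Hge : Rbar_le ((nu + 1) / 2) (Glb_Rbar S)).
{ apply Hglb; intros x [Hx Hxz]; simpl; apply bessel_J_zero_ge; auto; lra. }
specialize (Hlb x0 Hx0) as Hle.
destruct (Glb_Rbar S) as [g | |]; simpl in Hge, Hle |- *; try easy.
assert (Hg : 0 < g) by lra; split; auto.
(* If J(g) were nonzero, J would have no zero in [g, g + e), and g + e would be a larger lower
   bound. *)
apply NNPP; intros Hnz.
destruct (continuity_pt_locally (bessel_J nu) g) as [Hc _].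
specialize (Hc (continuity_pt_bessel_J nu g Hnu Hg)).
destruct (Hc (mkposreal _ (Rabs_pos_lt _ Hnz))) as [e He].
assert (Hcontra : Rbar_le (g + e) g); [|simpl in Hcontra; destruct e; simpl in *; lra].
apply Hglb; intros x Hx; simpl; apply Rnot_lt_le; intros Hlt.
assert (Hgx : g <= x) by exact (Hlb x Hx).
assert (Hb : Rabs (bessel_J nu x - bessel_J nu g) < Rabs (bessel_J nu g)).
{ apply He; unfold ball; simpl; unfold AbsRing_ball, abs, minus, plus, opp; simpl.
  apply Rabs_def1; destruct e; simpl in *; lra. }
destruct Hx as [_ Hx]; rewrite Hx, Rminus_0_l, Rabs_Ropp in Hb; lra.
Qed.

(** * Observability on [a, b] *)

(** The double zeros at a and b cancel the boundary terms, which involve [cutoff] and [cutoff']. *)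
Definition cutoff (a b x : R) : R := (x - a) ^ 2 * (b - x) ^ 2.
Definition cutoff' (a b x : R) : R := 2 * (x - a) * (b - x) * (a + b - 2 * x).

(* [(x * cutoff')'] *)
Definition cutoff'' (a b x : R) : R :=
  cutoff' a b x + x * (2 * (a + b - 2 * x) ^ 2 - 4 * (x - a) * (b - x)).

(* Integrating [(chi Y Z - x chi' Y^2 / 2)'] over [a, b] turns the kinetic part of
   the energy [E = Z^2 + P Y^2] into a multiple of [Y^2]; and [E] cannot decay by
   more than a fixed factor between [x] and [l]. *)
Lemma energy_observability (a b l : R) : 0 < a -> a < b -> b < l ->
  exists c, 0 < c /\
  forall (k N M : R) (P Y Z : R -> R),
  0 <= k <= 1 -> 0 <= N <= 1 / 4 -> 1 / 4 <= M ->
  (forall x, a <= x <= l -> M ^ 2 * (a / l) <= P x <= M ^ 2) ->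
  (forall x, a <= x <= l -> is_derive P x (k * P x / x)) ->
  (forall x, a <= x <= l -> is_derive Y x (Z x / x)) ->
  (forall x, a <= x <= l -> is_derive Z x ((N - P x) * Y x / x)) ->
  Y l = 0 ->
  c * Z l ^ 2 <= M ^ 2 * RInt (fun x => Y x ^ 2) a b.
Proof.
intros Ha Hab Hbl.
destruct (continuity_ab_maj (fun x => cutoff a b x / x) a b) as [x1 [Hx1 _]]; [lra| |].
{ intros x Hx; apply continuity_pt_filterlim.
  apply (@ex_derive_continuous R_AbsRing R_NormedModule (fun x => cutoff a b x / x)).
  unfold cutoff; auto_derive; lra. }
destruct (continuity_ab_maj (cutoff'' a b) a b) as [x2 [Hx2 _]]; [lra| |].
{ intros x Hx; apply continuity_pt_filterlim.
  apply (@ex_derive_continuous R_AbsRing R_NormedModule).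
  unfold cutoff'', cutoff'; auto_derive; auto. }
set (K1 := Rabs (cutoff a b x1 / x1)); set (K2 := Rabs (cutoff'' a b x2)).
assert (HK1 : forall x, a <= x <= b -> cutoff a b x / x <= K1).
{ intros x Hx; eapply Rle_trans; [exact (Hx1 x Hx) | apply Rle_abs]. }
assert (HK2 : forall x, a <= x <= b -> cutoff'' a b x <= K2).
{ intros x Hx; eapply Rle_trans; [exact (Hx2 x Hx) | apply Rle_abs]. }
assert (HK1p : 0 <= K1) by apply Rabs_pos.
assert (HK2p : 0 <= K2) by apply Rabs_pos.
clearbody K1 K2; clear x1 x2 Hx1 Hx2.
(* The coefficient of Y^2 to absorb is at most 2 K1 M^2 + K2/2, and K2/2 <= 8 K2 M^2 since M^2 >=
   1/16. *)
set (K := 2 * K1 + 8 * K2 + 1).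
assert (HK : 0 < K) by (unfold K; lra).
assert (Hccont : forall x, continuous (cutoff a b) x).
{ intros x; apply (@ex_derive_continuous R_AbsRing R_NormedModule).
  unfold cutoff; auto_derive; auto. }
assert (HI : 0 < RInt (cutoff a b) a b).
{ apply RInt_gt_0; auto; intros x Hx; unfold cutoff; apply Rmult_lt_0_compat;
    apply pow_lt; lra. }
set (I := RInt (cutoff a b) a b) in *.
(* [C] is a Gronwall rate for E: 2 N Y Z <= Z^2 + Y^2/4, and Y^2/4 <= 4 (l/a) P Y^2 because P >=
   (a/l)/16. The loss over [a, l] is then at most the factor [d]. *)
set (C := (1 + 4 * (l / a)) / a).
set (d := exp (- (C * (l - a)))).
assert (Hd : 0 < d) by apply exp_pos.
exists (d / b * I / K); split.
{ repeat apply Rdiv_lt_0_compat || apply Rmult_lt_0_compat; auto; lra. }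
intros k N M P Y Z Hk HN HM HP HdP HdY HdZ HYl.
assert (HM2 : 1 / 16 <= M ^ 2) by nra.
assert (Hla : 0 < l / a) by (apply Rdiv_lt_0_compat; lra).
assert (HC : 0 < C) by (unfold C; apply Rdiv_lt_0_compat; lra).
assert (Hal : 0 < a / l) by (apply Rdiv_lt_0_compat; lra).
assert (HP0 : forall x, a <= x <= l -> 1 / 4 <= 4 * (l / a) * P x).
{ intros x Hx; destruct (HP x Hx) as [HPx _].
  replace (1 / 4) with (4 * (l / a) * (1 / 16 * (a / l))) by (field; lra).
  apply Rmult_le_compat_l; [lra|]; nra. }
assert (HPpos : forall x, a <= x <= l -> 0 <= P x).
{ intros x Hx; destruct (HP x Hx) as [HPx _]; nra. }
set (E := fun x => Z x ^ 2 + P x * Y x ^ 2).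
assert (HE : forall x, a <= x <= l -> d * Z l ^ 2 <= E x).
{ intros x Hx.
  assert (H := gronwall_le E
    (fun x => (2 * N * (Y x * Z x) + k * P x * Y x ^ 2) / x) C x l ltac:(lra)).
  replace (E l) with (Z l ^ 2) in H by (unfold E; rewrite HYl; ring).
  apply Rle_trans with (d * (exp (C * (l - x)) * E x)).
  - apply Rmult_le_compat_l; [lra|]; apply H; intros t Ht.
    + specialize (HdP t ltac:(lra)); specialize (HdY t ltac:(lra)).
      specialize (HdZ t ltac:(lra)); unfold E.
      auto_derive; [repeat split; eexists; eauto|].
      change (Derive (fun x0 : R => P x0) t) with (Derive P t).
      change (Derive (fun x0 : R => Y x0) t) with (Derive Y t).
      change (Derive (fun x0 : R => Z x0) t) with (Derive Z t).
      rewrite (is_derive_unique _ _ _ HdP), (is_derive_unique _ _ _ HdY),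
        (is_derive_unique _ _ _ HdZ).
      unfold Rminus, Rdiv; real_eq; ring.
    + specialize (HP0 t ltac:(lra)); specialize (HPpos t ltac:(lra)).
      apply Rle_trans with ((1 + 4 * (l / a)) * E t / t).
      * apply Rmult_le_compat_r; [apply Rlt_le, Rinv_0_lt_compat; lra|].
        assert (H1 : 2 * N * (Y t * Z t) <= Z t ^ 2 + 1 / 4 * Y t ^ 2).
        { generalize (pow2_ge_0 (Y t - Z t)) (pow2_ge_0 (Y t)) (pow2_ge_0 (Z t)); nra. }
        assert (H2 : 1 / 4 * Y t ^ 2 <= 4 * (l / a) * P t * Y t ^ 2).
        { apply Rmult_le_compat_r; auto using pow2_ge_0. }
        assert (H3 : k * (P t * Y t ^ 2) <= 1 * (P t * Y t ^ 2)).
        { apply Rmult_le_compat_r; [|lra]; auto using Rmult_le_pos, pow2_ge_0. }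
        assert (H4 : 0 <= 4 * (l / a) * Z t ^ 2).
        { apply Rmult_le_pos; [lra | apply pow2_ge_0]. }
        unfold E; lra.
      * unfold C; assert (HEt : 0 <= (1 + 4 * (l / a)) * E t).
        { unfold E; apply Rmult_le_pos; [lra|]; apply Rplus_le_le_0_compat;
            auto using Rmult_le_pos, pow2_ge_0. }
        assert (Hinv : / t <= / a) by (apply Rinv_le_contravar; lra).
        unfold Rdiv; unfold Rdiv in HEt; nra.
  - rewrite <- Rmult_assoc; unfold d; rewrite <- exp_plus.
    rewrite <- (Rmult_1_l (E x)) at 2; apply Rmult_le_compat_r.
    + unfold E; apply Rplus_le_le_0_compat; auto using Rmult_le_pos, pow2_ge_0.
    + rewrite <- exp_0; apply exp_nondecreasing; nra. }
assert (HYc : forall x, a <= x <= b -> continuous (fun x => Y x ^ 2) x).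
{ intros x Hx; apply (@ex_derive_continuous R_AbsRing R_NormedModule).
  specialize (HdY x ltac:(lra)); auto_derive; eexists; eauto. }
(* [h] is the derivative of [H] below, whose second term is chosen to cancel chi' Y Z. *)
set (h := fun x => cutoff a b x * Z x ^ 2 / x + cutoff a b x * (N - P x) * Y x ^ 2 / x
  - cutoff'' a b x * Y x ^ 2 / 2).
assert (Hh : is_RInt h a b 0).
{ set (H := fun x => cutoff a b x * (Y x * Z x) - x * cutoff' a b x * Y x ^ 2 / 2).
  replace 0 with (minus (H b) (H a)).
  2: { unfold minus, plus, opp, H, cutoff, cutoff'; simpl; real_eq; field. }
  apply (is_RInt_derive (V := R_CompleteNormedModule) H); intros x; rewrite Rmin_left, Rmax_right by lra; intros Hx.
  - specialize (HdP x ltac:(lra)); specialize (HdY x ltac:(lra)).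
    specialize (HdZ x ltac:(lra)); unfold H, h, cutoff, cutoff'', cutoff'.
    auto_derive; [repeat split; eexists; eauto|].
    change (Derive (fun x0 : R => Y x0) x) with (Derive Y x).
    change (Derive (fun x0 : R => Z x0) x) with (Derive Z x).
    rewrite (is_derive_unique _ _ _ HdY), (is_derive_unique _ _ _ HdZ).
    unfold Rminus, Rdiv; real_eq; field; lra.
  - apply (@ex_derive_continuous R_AbsRing R_NormedModule).
    specialize (HdP x ltac:(lra)); specialize (HdY x ltac:(lra)).
    specialize (HdZ x ltac:(lra)); unfold H, h, cutoff, cutoff'', cutoff'.
    auto_derive; repeat split; try lra; eexists; eauto. }
set (g := fun x => d * Z l ^ 2 / b * cutoff a b x - K * M ^ 2 * Y x ^ 2).
assert (Hg : is_RInt g a b (d * Z l ^ 2 / b * I - K * M ^ 2 * RInt (fun x => Y x ^ 2) a b)).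
{ apply (is_RInt_minus (fun x => d * Z l ^ 2 / b * cutoff a b x)
    (fun x => K * M ^ 2 * Y x ^ 2));
  apply (is_RInt_scal (V := R_NormedModule)); apply (RInt_correct (V := R_CompleteNormedModule));
  apply (@ex_RInt_continuous R_CompleteNormedModule); intros x;
  rewrite Rmin_left, Rmax_right by lra; auto. }
assert (Hgh : RInt g a b <= RInt h a b).
{ apply RInt_le; [lra | eexists; apply Hg | eexists; apply Hh |].
  intros x Hx.
  assert (Hcx : 0 <= cutoff a b x) by (apply Rmult_le_pos; apply pow2_ge_0).
  specialize (HE x ltac:(lra)); specialize (HK1 x ltac:(lra)).
  specialize (HK2 x ltac:(lra)); destruct (HP x ltac:(lra)) as [_ HPx].
  specialize (HPpos x ltac:(lra)).
  assert (Hcx' : 0 <= cutoff a b x / x)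
    by (apply Rmult_le_pos; [lra | apply Rlt_le, Rinv_0_lt_compat; lra]).
  (* Substituting Z^2 = E - P Y^2 leaves E, bounded below by d Z(l)^2, and a multiple of Y^2. *)
  replace (h x) with (cutoff a b x / x * E x
    - (cutoff a b x / x * (2 * P x - N) + cutoff'' a b x / 2) * Y x ^ 2)
    by (unfold h, E; field; lra).
  assert (H1 : d * Z l ^ 2 / b * cutoff a b x <= cutoff a b x / x * E x).
  { apply Rle_trans with (cutoff a b x / x * (d * Z l ^ 2)); [|now apply Rmult_le_compat_l].
    replace (d * Z l ^ 2 / b * cutoff a b x)
      with (d * Z l ^ 2 * cutoff a b x * / b) by (unfold Rdiv; ring).
    replace (cutoff a b x / x * (d * Z l ^ 2))
      with (d * Z l ^ 2 * cutoff a b x * / x) by (unfold Rdiv; ring).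
    apply Rmult_le_compat_l; [|apply Rinv_le_contravar; lra].
    apply Rmult_le_pos; auto; apply Rmult_le_pos; [lra | apply pow2_ge_0]. }
  assert (H2 : cutoff a b x / x * (2 * P x - N) + cutoff'' a b x / 2 <= K * M ^ 2).
  { unfold K. assert (cutoff a b x / x * (2 * P x - N) <= K1 * (2 * M ^ 2)); [|nra].
    apply Rle_trans with (cutoff a b x / x * (2 * M ^ 2)).
    - apply Rmult_le_compat_l; lra.
    - apply Rmult_le_compat_r; nra. }
  assert (H3 := Rmult_le_compat_r (Y x ^ 2) _ _ (pow2_ge_0 _) H2).
  unfold g; lra. }
rewrite (is_RInt_unique _ _ _ _ Hg), (is_RInt_unique _ _ _ _ Hh) in Hgh.
apply Rmult_le_reg_l with K; auto.
replace (K * (d / b * I / K * Z l ^ 2)) with (d * Z l ^ 2 / b * I) by (field; lra).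
lra.
Qed.

(* In the variable [X = j (x/l)^kappa], [x d/dx = kappa * X d/dX]. *)
Lemma bessel_observability (a b l : R) : 0 < a -> a < b -> b < l ->
  exists c, 0 < c /\
  forall nu j, 0 <= nu -> 0 < j -> bessel_J nu j = 0 ->
  let kappa := / (2 * (nu + 1)) in
  c * Derive (bessel_J nu) j ^ 2 <=
    RInt (fun x => bessel_J nu (j * Rpower (x / l) kappa) ^ 2) a b.
Proof.
intros Ha Hab Hbl.
destruct (energy_observability a b l Ha Hab Hbl) as [c [Hc Hobs]].
exists c; split; auto; intros nu j Hnu Hj Hz kappa.
assert (Hk : 0 < kappa) by (apply Rinv_0_lt_compat; lra).
assert (Hk1 : 2 * kappa * (nu + 1) = 1) by (unfold kappa; field; lra).
set (X := fun x => j * Rpower (x / l) kappa).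
assert (HX : forall x, 0 < X x) by (intros x; apply Rmult_lt_0_compat; [auto | apply exp_pos]).
assert (HdX : forall x, a <= x <= l -> is_derive X x (kappa * X x / x)).
{ intros x Hx; unfold X, Rpower; auto_derive.
  - apply Rdiv_lt_0_compat; lra.
  - unfold Rdiv; real_eq; field; lra. }
assert (HXl : X l = j).
{ unfold X, Rpower; rewrite Rdiv_diag, ln_1, Rmult_0_r, exp_0 by lra; ring. }
assert (H := Hobs (2 * kappa) ((kappa * nu) ^ 2) (kappa * j)
  (fun x => kappa ^ 2 * X x ^ 2) (fun x => bessel_J nu (X x))
  (fun x => kappa * bessel_xJ' nu (X x))).
cbv beta in H; rewrite HXl in H.
rewrite (is_derive_unique _ _ _ (is_derive_bessel_J nu j Hnu Hj)).
(* Here M = kappa j and Z(l) = kappa j J'(j), so the factor M^2 cancels and the constant is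
   independent of nu and j. *)
apply Rmult_le_reg_l with ((kappa * j) ^ 2); [apply pow_lt; nra|].
replace ((kappa * j) ^ 2 * (c * (bessel_xJ' nu j / j) ^ 2))
  with (c * (kappa * bessel_xJ' nu j) ^ 2) by (field; lra).
assert (Hkn : 0 <= kappa * nu) by (apply Rmult_le_pos; lra).
assert (Hkj : 1 / 4 <= kappa * j).
{ apply Rle_trans with (kappa * ((nu + 1) / 2)); [lra|].
  apply Rmult_le_compat_l; [lra | now apply bessel_J_zero_ge]. }
assert (Hkn2 : 0 <= (kappa * nu) ^ 2 <= 1 / 4).
{ split; [apply pow2_ge_0|]; replace (1 / 4) with ((1 / 2) ^ 2) by field.
  apply pow_incr; lra. }
apply H; auto; try lra; clear H Hobs.
- intros x Hx.
  assert (Hxl : 0 < x / l) by (apply Rdiv_lt_0_compat; lra).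
  assert (Hxl1 : x / l <= 1).
  { apply Rmult_le_reg_r with l; [lra|]; unfold Rdiv; rewrite Rmult_assoc, Rinv_l; lra. }
  assert (Hln : ln (x / l) <= 0) by (rewrite <- ln_1; apply ln_le; lra).
  assert (Hsq : kappa ^ 2 * X x ^ 2 = (kappa * j) ^ 2 * exp (2 * kappa * ln (x / l))).
  { unfold X, Rpower; replace (2 * kappa * ln (x / l))
      with (kappa * ln (x / l) + kappa * ln (x / l)) by ring; rewrite exp_plus; ring. }
  rewrite Hsq; assert (Hm := pow2_ge_0 (kappa * j)); split.
  + apply Rmult_le_compat_l; auto.
    (* Since 2 kappa <= 1 and x/l <= 1, (x/l)^(2 kappa) >= x/l >= a/l. *)
    apply Rle_trans with (x / l).
    * apply Rmult_le_compat_r; [apply Rlt_le, Rinv_0_lt_compat|]; lra.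
    * rewrite <- (exp_ln (x / l)) at 1 by auto; apply exp_nondecreasing; nra.
  + rewrite <- (Rmult_1_r ((kappa * j) ^ 2)) at 2; apply Rmult_le_compat_l; auto.
    rewrite <- exp_0; apply exp_nondecreasing; nra.
- intros x Hx; specialize (HdX x Hx).
  auto_derive; [repeat split; eexists; eauto|].
  change (Derive (fun x0 : R => X x0) x) with (Derive X x).
  rewrite (is_derive_unique _ _ _ HdX); unfold Rdiv; real_eq; ring.
- intros x Hx; specialize (HdX x Hx); specialize (HX x); evar_last.
  + apply (is_derive_comp (bessel_J nu) X); [apply is_derive_bessel_J; auto | exact HdX].
  + unfold scal; simpl; unfold mult; simpl; unfold Rdiv; real_eq; field; lra.
- intros x Hx; specialize (HdX x Hx); specialize (HX x); evar_last.
  + apply is_derive_scal, (is_derive_comp (bessel_xJ' nu) X);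
      [apply is_derive_bessel_xJ'; auto | exact HdX].
  + unfold scal; simpl; unfold mult; simpl; unfold Rdiv; real_eq; field; lra.
Qed.

(** * The normalised eigenfunctions *)

Lemma Rabs_ln_le (a b x : R) : 0 < a -> a <= x <= b ->
  Rabs (ln x) <= Rabs (ln a) + Rabs (ln b).
Proof.
intros Ha Hx.
assert (ln a <= ln x) by (apply ln_le; lra).
assert (ln x <= ln b) by (apply ln_le; lra).
generalize (Rle_abs (ln b)) (Rle_abs (- ln a)) (Rabs_pos (ln a)) (Rabs_pos (ln b)).
rewrite Rabs_Ropp; intros; apply Rabs_le; lra.
Qed.

Theorem proposition2p5 (a b l : R) (ha : 0 < a) (hab : a < b) (hbl : b < l) :
  exists gamma0 : R, 0 < gamma0 /\
    forall (alpha : R) (m : nat), 1 <= alpha < 2 -> (1 <= m)%nat ->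
      RInt (fun x => Phi l alpha m x ^ 2) a b >= gamma0 * (2 - alpha).
Proof.
destruct (bessel_observability a b l ha hab hbl) as [c [Hc Hobs]].
(* [q] bounds the weight x^(1 - alpha) l^(-2 kappa) from below on [a, b], uniformly in alpha, as |1
   - alpha| <= 1 and 2 kappa <= 1. *)
set (q := exp (- (2 * Rabs (ln l) + Rabs (ln a) + Rabs (ln b)))).
assert (Hq : 0 < q) by apply exp_pos.
exists (q * c); split; [now apply Rmult_lt_0_compat|].
intros alpha m Halpha Hm.
set (nu := nu_of alpha); set (kappa := kappa_of alpha).
assert (Hnu : 0 <= nu).
{ apply Rmult_le_pos; [lra | apply Rlt_le, Rinv_0_lt_compat; lra]. }
assert (Hkappa : kappa = / (2 * (nu + 1))).
{ unfold kappa, kappa_of, nu, nu_of; field; repeat split; lra. }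
assert (Hk : 0 < kappa <= 1 / 2) by (unfold kappa, kappa_of; lra).
destruct (bessel_zero_nonneg_spec nu m Hnu) as [_ Hzero].
destruct (Hzero Hm) as [Hj Hz]; set (j := bessel_zero nu m) in *.
assert (HJ' := bessel_J_derive_neq_0 nu j Hnu Hj Hz).
assert (HD := Hobs nu j Hnu Hj Hz); simpl in HD; rewrite <- Hkappa in HD.
set (D := Derive (bessel_J nu) j) in *.
assert (HDne : D <> 0).
{ unfold D; rewrite (is_derive_unique _ _ _ (is_derive_bessel_J nu j Hnu Hj)).
  apply Rmult_integral_contrapositive; split; auto; apply Rinv_neq_0_compat; lra. }
assert (HD2 : 0 < D ^ 2) by (apply pow2_gt_0; auto).
set (Y := fun x => bessel_J nu (j * Rpower (x / l) kappa)) in *.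
assert (HYd : forall x, a <= x <= b -> ex_derive Y x).
{ intros x Hx; apply (ex_derive_comp (bessel_J nu) (fun x => j * Rpower (x / l) kappa)).
  - eexists; apply is_derive_bessel_J; [exact Hnu|].
    apply Rmult_lt_0_compat; auto; apply exp_pos.
  - unfold Rpower; auto_derive; apply Rdiv_lt_0_compat; lra. }
assert (HPhi : forall x, Phi l alpha m x ^ 2 =
  2 * kappa / D ^ 2 * exp ((1 - alpha) * ln x - 2 * kappa * ln l) * Y x ^ 2).
{ intros x; unfold Phi; cbv zeta; fold nu kappa j; fold D; fold (Y x).
  unfold Rpower, Rdiv; rewrite !Rpow_mult_distr, pow2_sqrt, pow_inv, Rpow_mult_distr,
    pow2_abs by lra.
  replace ((1 - alpha) * ln x - 2 * kappa * ln l)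
    with ((1 - alpha) * / 2 * ln x + (1 - alpha) * / 2 * ln x
      + - (kappa * ln l) + - (kappa * ln l)) by field.
  rewrite !exp_plus, !exp_Ropp; field; split; auto; apply Rgt_not_eq, exp_pos. }
apply Rle_ge, Rle_trans with (RInt (fun x => 2 * kappa / D ^ 2 * q * Y x ^ 2) a b).
- rewrite (RInt_scal (V := R_CompleteNormedModule) (fun x => Y x ^ 2)).
  2: { apply (@ex_RInt_continuous R_CompleteNormedModule); intros x.
    rewrite Rmin_left, Rmax_right by lra; intros Hx.
    apply (@ex_derive_continuous R_AbsRing R_NormedModule).
    specialize (HYd x Hx); auto_derive; auto. }
  (* The normalisation 1/D^2 cancels the D^2 of the observability bound and leaves 2 kappa = 2 -
     alpha. *)
  replace (q * c * (2 - alpha)) with (2 * kappa / D ^ 2 * q * (c * D ^ 2))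
    by (unfold kappa, kappa_of; field; auto).
  apply Rmult_le_compat_l; [|exact HD].
  apply Rmult_le_pos; [apply Rlt_le, Rdiv_lt_0_compat|]; lra.
- apply RInt_le; [lra | | |].
  + apply (@ex_RInt_continuous R_CompleteNormedModule); intros x.
    rewrite Rmin_left, Rmax_right by lra; intros Hx.
    apply (@ex_derive_continuous R_AbsRing R_NormedModule).
    specialize (HYd x Hx); auto_derive; auto.
  + apply (@ex_RInt_continuous R_CompleteNormedModule); intros x.
    rewrite Rmin_left, Rmax_right by lra; intros Hx.
    apply continuous_ext with (1 := fun x => eq_sym (HPhi x)).
    apply (@ex_derive_continuous R_AbsRing R_NormedModule).
    specialize (HYd x Hx); auto_derive; repeat split; auto; lra.
  + intros x Hx; rewrite HPhi; apply Rmult_le_compat_r; [apply pow2_ge_0|].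
    apply Rmult_le_compat_l; [apply Rlt_le, Rdiv_lt_0_compat; lra|].
    apply exp_nondecreasing.
    assert (H1 := Rabs_ln_le a b x ha ltac:(lra)).
    assert (H2 : Rabs ((1 - alpha) * ln x) <= Rabs (ln x)).
    { rewrite Rabs_mult, (Rabs_left1 (1 - alpha)) by lra.
      generalize (Rabs_pos (ln x)); nra. }
    assert (H3 : Rabs (2 * kappa * ln l) <= 2 * Rabs (ln l)).
    { rewrite Rabs_mult, (Rabs_right (2 * kappa)) by lra.
      generalize (Rabs_pos (ln l)); nra. }
    generalize (Rle_abs (- ((1 - alpha) * ln x))) (Rle_abs (2 * kappa * ln l)).
    rewrite Rabs_Ropp; lra.
Qed.
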